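(* Let $F$ be an arbitrary field of characteristic $\neq 2$. Then the $2$-valued group $\mathcal{X}_F=(F/\iota)\times(F^\times/\iota)$ is double coset, i.e. there exist a group $G$ and a subgroup $H\subset G$ of order $2$ such that $\mathcal{X}_F$ is isomorphic to the double coset group $H\backslash G/H$.
   Context: Let $\iota$ denote the involution $f\mapsto -f$; $[a]$ with a single entry denotes the class $\{a,-a\}$, and $[x_1,\dots,x_k]$ with $k\geq 2$, or $[x_h]_{h\in H}$, denotes a multiset. For a field $F$, $\mathcal{X}_F$ is the $2$-valued group $(F/\iota)\times(F^\times/\iota)$ with the operation $$([a],[b])*([c],[d])=\bigl[([a+bc],[bd]),([a-bc],[bd])\bigr].$$ For a group $G$ and a subgroup $H$ of order $n$, the double coset group $H\backslash G/H$ is the set of double cosets $\{HgH\mid g\in G\}$ with the $n$-valued operation (a multiset of $n$ double cosets) $Hg_1H*Hg_2H=[Hg_1hg_2H]_{h\in H}$. An isomorphism of $2$-valued groups is a bijection $f$ such that $f(x)*f(y)$ is the image multiset $f(x*y)$ for all $x,y$. *)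

(* Defs.v *)
From HB Require Import structures.
From mathcomp Require Import all_boot all_algebra.
From mathcomp Require Import finmap multiset boolp.

Set Implicit Arguments.
Unset Strict Implicit.
Unset Printing Implicit Defensive.

Import GRing.Theory.

Local Open Scope fset_scope.
Local Open Scope mset_scope.

Section MultisetOperations.
Variables K L : choiceType.

Definition mset_map (f : K -> L) (A : {mset K}) : {mset L} :=
  seq_mset [seq f x | x <- A].

(* The sum, with multiplicities, of the multisets [f x] for [x] in [A]. *)
Definition mset_bind (A : {mset K}) (f : K -> {mset L}) : {mset L} :=
  seq_mset (flatten [seq (f x : seq L) | x <- A]).

Lemma mset_bindE (A : {mset K}) (f : K -> {mset L}) z :
  mset_bind A f z = \sum_(x <- A) f x z.
Proof.
rewrite mset_seqE count_flatten -map_comp sumn_map.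
by apply: eq_bigr => x _ /=; rewrite count_mem_mset.
Qed.

Lemma mset_bind_seq (s : seq K) (f : K -> {mset L}) (ss : seq (seq L)) :
  [seq f x | x <- s] = [seq seq_mset r | r <- ss] ->
  mset_bind (seq_mset s) f = seq_mset (flatten ss).
Proof.
move=> e; apply/msetP => z; rewrite mset_bindE.
rewrite (perm_big _ (perm_eq_seq_mset s)) /= mset_seqE count_flatten.
transitivity (sumn [seq A z | A : {mset L} <- [seq f x | x <- s]]).
  by rewrite -map_comp sumn_map.
by rewrite e -map_comp; congr sumn; apply: eq_map => r /=; rewrite mset_seqE.
Qed.

End MultisetOperations.

Lemma size_seq_mset (K : choiceType) (s : seq K) : size (seq_mset s) = size s.
Proof. exact: perm_size (perm_eq_seq_mset s). Qed.

Lemma seq_mset2C (K : choiceType) (a b : K) :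
  seq_mset [:: a; b] = seq_mset [:: b; a].
Proof. by apply/eq_seq_msetP; rewrite -cat1s perm_catC. Qed.

Lemma map_nseq_cst (K : eqType) (L : Type) (f : K -> L) (s : seq K) y :
  {in s, forall x, f x = y} -> [seq f x | x <- s] = nseq (size s) y.
Proof.
elim: s => //= a s IHs e; rewrite e ?mem_head // IHs // => x xs.
by rewrite e // in_cons xs orbT.
Qed.

(* An associative operation with values in multisets of cardinality [n]; in the
   associativity law the two sides are multisets of cardinality [n ^ 2]. *)
Record nvalued_group (n : nat) := NValuedGroup {
  nvg_sort :> choiceType;
  nvg_op : nvg_sort -> nvg_sort -> {mset nvg_sort};
  nvg_one : nvg_sort;
  nvg_inv : nvg_sort -> nvg_sort;
  nvg_size : forall x y, size (nvg_op x y) = n;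
  nvg_assoc : forall x y z,
    mset_bind (nvg_op y z) (fun t => nvg_op x t) =
    mset_bind (nvg_op x y) (fun t => nvg_op t z);
  nvg_op1x : forall x, nvg_op nvg_one x = msetn n x;
  nvg_opx1 : forall x, nvg_op x nvg_one = msetn n x;
  nvg_opVx : forall x, nvg_one \in nvg_op (nvg_inv x) x;
  nvg_opxV : forall x, nvg_one \in nvg_op x (nvg_inv x)
}.

Definition nvg_isomorphism n m (X : nvalued_group n) (Y : nvalued_group m)
    (f : X -> Y) : Prop :=
  bijective f /\
  forall x y : X, nvg_op (f x) (f y) = mset_map f (nvg_op x y).

Definition nvg_isomorphic n m (X : nvalued_group n) (Y : nvalued_group m) : Prop :=
  exists f : X -> Y, nvg_isomorphism f.

(* If [c t] is the class of [t], as a set, then [classes c] is the set of all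
   the classes; [cls c t] is [c t] as an element of it. *)
Section Classes.
Variables (T U : choiceType) (c : T -> U).

Definition classes : Type := {u : U | `[< exists t, c t = u >]}.
HB.instance Definition _ := Choice.on classes.

Definition cls (t : T) : classes :=
  exist _ (c t) (asboolT (ex_intro (fun s => c s = c t) t erefl)).

Definition rep (A : classes) : T := sval (cid (asboolW (svalP A))).

Lemma cls_eq t t' : cls t = cls t' <-> c t = c t'.
Proof. by split=> [/(congr1 sval)|e]; last exact: val_inj. Qed.

Lemma repP t : c (rep (cls t)) = c t.
Proof. by rewrite /rep; case: cid. Qed.

Lemma repK A : cls (rep A) = A.
Proof. by apply: val_inj; rewrite /= /rep; case: cid. Qed.

End Classes.

Section XF.
Variable F : fieldType.
Local Open Scope ring_scope.

Definition nonzero : Type := {x : F | x != 0}.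
HB.instance Definition _ := Choice.on nonzero.

Definition nz1 : nonzero := exist _ 1 (oner_neq0 F).

Definition nzM (b d : nonzero) : nonzero :=
  exist _ (val b * val d) (mulf_neq0 (valP b) (valP d)).

Definition nzV (b : nonzero) : nonzero :=
  exist _ (val b)^-1 (invr_neq0 (valP b)).

Definition pm (a : F) : {fset F} := [fset a; - a].
Definition nzpm (b : nonzero) : {fset F} := pm (val b).

Lemma pmP a a' : pm a = pm a' <-> a' = a \/ a' = - a.
Proof.
split=> [e|[->|->]] //; last by rewrite /pm opprK fsetUC.
by apply/fset2P; rewrite -/(pm a) e /pm !inE eqxx.
Qed.

Definition XF_sort : Type := (classes pm * classes nzpm)%type.
HB.instance Definition _ := Choice.on XF_sort.

Definition XF_cls (a : F) (b : nonzero) : XF_sort := (cls pm a, cls nzpm b).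

Definition XF_op (x y : XF_sort) : {mset XF_sort} :=
  let: (a, b) := (rep x.1, rep x.2) in
  let: (c, d) := (rep y.1, rep y.2) in
  seq_mset [:: XF_cls (a + val b * c) (nzM b d);
               XF_cls (a - val b * c) (nzM b d)].

(* The operation is given by the defining formula on arbitrary representatives. *)
Lemma XF_opE a b c d :
  XF_op (XF_cls a b) (XF_cls c d) =
  seq_mset [:: XF_cls (a + val b * c) (nzM b d);
               XF_cls (a - val b * c) (nzM b d)].
Proof.
rewrite /XF_op /=.
set a' := rep _; set b' := rep _; set c' := rep _; set d' := rep _.
have /esym/pmP ea : pm a' = pm a by exact: repP.
have /esym/pmP eb : pm (val b') = pm (val b) by exact: (repP nzpm b).
have /esym/pmP ec : pm c' = pm c by exact: repP.
have /esym/pmP ed : pm (val d') = pm (val d) by exact: (repP nzpm d).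
move: a' b' c' d' ea eb ec ed => a' b' c' d' ea eb ec ed.
rewrite /XF_cls.
have -> : cls nzpm (nzM b' d') = cls nzpm (nzM b d).
  apply/cls_eq/pmP => /=.
  by case: eb => ->; case: ed => ->; rewrite ?mulrN ?mulNr ?opprK; auto.
pose T x : XF_sort := (cls pm x, cls nzpm (nzM b d)).
have TN x y : x = - y -> T x = T y.
  move=> ->; congr (_, _); apply/cls_eq/pmP; rewrite opprK; exact: or_intror.
pose S x y : {mset XF_sort} := seq_mset [:: T (x + y); T (x - y)].
have SNr x y : S x (- y) = S x y by rewrite /S opprK; exact: seq_mset2C.
have SNl x y : S (- x) y = S x y.
  rewrite /S (TN (- x + y) (x - y)) ?(TN (- x - y) (x + y)); first exact: seq_mset2C.
  - by rewrite opprD.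
  - by rewrite opprB addrC.
rewrite -[LHS]/(S a' (val b' * c')) -[RHS]/(S a (val b * c)).
by case: ea => ->; case: eb => ->; case: ec => ->;
  rewrite ?mulrN ?mulNr ?opprK ?SNl ?SNr.
Qed.

Lemma XF_sort_ind (P : XF_sort -> Prop) :
  (forall a b, P (XF_cls a b)) -> forall x, P x.
Proof. by move=> h [x y]; rewrite -[x]repK -[y]repK; apply: h. Qed.

Definition XF_one : XF_sort := XF_cls 0 nz1.

Definition XF_inv (x : XF_sort) : XF_sort :=
  XF_cls (rep x.1 / val (rep x.2)) (nzV (rep x.2)).

Lemma XF_size x y : size (XF_op x y) = 2.
Proof. by rewrite /XF_op size_seq_mset. Qed.

Lemma XF_assoc x y z :
  mset_bind (XF_op y z) (fun t => XF_op x t) =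
  mset_bind (XF_op x y) (fun t => XF_op t z).
Proof.
elim/XF_sort_ind: x => a b; elim/XF_sort_ind: y => c d.
elim/XF_sort_ind: z => e f.
rewrite (XF_opE c d e f) (XF_opE a b c d).
pose u := val b * c; pose v := val b * val d * e.
pose P w := XF_cls w (nzM (nzM b d) f).
pose l := [:: [:: P (a + u + v); P (a - u - v)];
              [:: P (a + u - v); P (a - u + v)]].
pose r := [:: [:: P (a + u + v); P (a + u - v)];
              [:: P (a - u + v); P (a - u - v)]].
transitivity (seq_mset (flatten l)).
  apply: mset_bind_seq.
  rewrite [LHS]/= !XF_opE /l /P.
  have <- : nzM b (nzM d f) = nzM (nzM b d) f by apply: val_inj; rewrite /= mulrA.
  by rewrite !mulrBr !mulrDr !opprD opprK !addrA !mulrA.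
transitivity (seq_mset (flatten r)); last first.
  by apply/esym/mset_bind_seq; rewrite [LHS]/= !XF_opE.
apply/eq_seq_msetP; rewrite /= perm_cons.
by rewrite -[X in perm_eq X]cat1s perm_catC.
Qed.

Lemma XF_op1x x : XF_op XF_one x = msetn 2 x.
Proof.
elim/XF_sort_ind: x => a b; rewrite XF_opE.
have -> : nzM nz1 b = b by apply: val_inj; rewrite /= mul1r.
rewrite mul1r add0r sub0r.
have -> : XF_cls (- a) b = XF_cls a b.
  by congr (_, _); apply/cls_eq/pmP; rewrite opprK; right.
by rewrite -[RHS]seq_mset_id enum_msetn.
Qed.

Lemma XF_opx1 x : XF_op x XF_one = msetn 2 x.
Proof.
elim/XF_sort_ind: x => a b; rewrite XF_opE.
have -> : nzM b nz1 = b by apply: val_inj; rewrite /= mulr1.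
by rewrite mulr0 subr0 addr0 -[RHS]seq_mset_id enum_msetn.
Qed.

Lemma XF_opVx x : XF_one \in XF_op (XF_inv x) x.
Proof.
case: x => A B; rewrite /XF_inv /=; set a := rep A; set b := rep B.
have -> : ((A, B) : XF_sort) = XF_cls a b by rewrite /XF_cls !repK.
rewrite XF_opE (perm_mem (perm_eq_seq_mset _)) !inE; apply/orP; right.
apply/eqP; congr (_, _); first by congr cls; rewrite mulrC subrr.
by congr cls; apply: val_inj; rewrite /= mulVf ?(valP b).
Qed.

Lemma XF_opxV x : XF_one \in XF_op x (XF_inv x).
Proof.
case: x => A B; rewrite /XF_inv /=; set a := rep A; set b := rep B.
have -> : ((A, B) : XF_sort) = XF_cls a b by rewrite /XF_cls !repK.
rewrite XF_opE (perm_mem (perm_eq_seq_mset _)) !inE; apply/orP; right.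
apply/eqP; congr (_, _).
  by congr cls; rewrite mulrCA mulfV ?(valP b) // mulr1 subrr.
by congr cls; apply: val_inj; rewrite /= mulfV ?(valP b).
Qed.

Definition XF : nvalued_group 2 :=
  NValuedGroup XF_size XF_assoc XF_op1x XF_opx1 XF_opVx XF_opxV.

End XF.

Local Open Scope group_scope.

(* The ambient group may be infinite. *)
Record finsubgroup (G : groupType) := FinSubgroup {
  fsg_set :> {fset G};
  fsg_closed : group_closed [in fsg_set]
}.

Section DoubleCosets.
Variables (G : groupType) (H : finsubgroup G).

Lemma fsg1 : 1 \in fsg_set H.
Proof. by case: H => A []. Qed.

Lemma fsgM : {in fsg_set H &, forall h k, h * k \in fsg_set H}.
Proof. exact/group_closedM/fsg_closed. Qed.

Lemma fsgV : {in fsg_set H, forall h, h^-1 \in fsg_set H}.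
Proof. exact/group_closedV/fsg_closed. Qed.

Definition dcoset (g : G) : {fset G} :=
  [fset h * g * k | h in fsg_set H, k in fsg_set H].

Lemma dcosetP g g' : reflect
  (exists h k, [/\ h \in fsg_set H, k \in fsg_set H & g' = h * g * k])
  (g' \in dcoset g).
Proof.
apply: (iffP idP) => [/imfset2P [h hH [k kH ->]]|[h [k [hH kH ->]]]].
  by exists h, k.
by apply/imfset2P; exists h => //; exists k.
Qed.

Lemma dcoset_eqP g g' : dcoset g = dcoset g' <->
  exists h k, [/\ h \in fsg_set H, k \in fsg_set H & g' = h * g * k].
Proof.
split=> [e|[h [k [hH kH ->]]]].
  by apply/dcosetP; rewrite e; apply/dcosetP; exists 1, 1; rewrite fsg1 mul1g mulg1.
apply/fsetP => x; apply/dcosetP/dcosetP => -[h' [k' [h'H k'H ->]]].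
  exists (h' * h^-1), (k^-1 * k'); rewrite !fsgM ?fsgV //; split=> //.
  by rewrite !mulgA mulgVK mulgK.
by exists (h' * h), (k * k'); rewrite !fsgM // !mulgA.
Qed.

Definition dc_sort : Type := classes dcoset.
HB.instance Definition _ := Choice.on dc_sort.

Definition dc_cls (g : G) : dc_sort := cls dcoset g.

Definition dc_op (x y : dc_sort) : {mset dc_sort} :=
  seq_mset [seq dc_cls (rep x * h * rep y) | h <- fsg_set H].

Lemma dc_sort_ind (P : dc_sort -> Prop) : (forall g, P (dc_cls g)) -> forall x, P x.
Proof. by move=> h x; rewrite -[x]repK; apply: h. Qed.

(* The operation is given by the defining formula on arbitrary representatives. *)
Lemma dc_opE g1 g2 : dc_op (dc_cls g1) (dc_cls g2) =
  seq_mset [seq dc_cls (g1 * h * g2) | h <- fsg_set H].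
Proof.
rewrite /dc_op; set a := rep _; set b := rep _.
have /esym/dcoset_eqP [h1 [k1 [h1H k1H ->]]] : dcoset a = dcoset g1 by exact: repP.
have /esym/dcoset_eqP [h2 [k2 [h2H k2H ->]]] : dcoset b = dcoset g2 by exact: repP.
apply/eq_seq_msetP; pose s h := k1 * h * h2.
have -> : [seq dc_cls (h1 * g1 * k1 * h * (h2 * g2 * k2)) | h <- fsg_set H] =
          [seq dc_cls (g1 * h * g2) | h <- [seq s h | h <- fsg_set H]].
  rewrite -map_comp; apply: eq_map => h; apply/cls_eq/esym/dcoset_eqP.
  by exists h1, k2; rewrite /s /= !mulgA.
apply: perm_map; apply: uniq_perm; rewrite ?fset_uniq //.
  by rewrite map_inj_uniq ?fset_uniq // => x y /mulIg /mulgI.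
move=> x; apply/mapP/idP => [[h hH ->]|xH]; first by rewrite !fsgM.
by exists (k1^-1 * x * h2^-1); rewrite ?fsgM ?fsgV // /s !mulgA mulgV mul1g mulgVK.
Qed.

Lemma dc_size x y : size (dc_op x y) = #|` fsg_set H|.
Proof. by rewrite size_seq_mset size_map. Qed.

Lemma dc_assoc x y z :
  mset_bind (dc_op y z) (fun t => dc_op x t) =
  mset_bind (dc_op x y) (fun t => dc_op t z).
Proof.
elim/dc_sort_ind: x => a; elim/dc_sort_ind: y => b; elim/dc_sort_ind: z => c.
rewrite (dc_opE b c) (dc_opE a b).
pose t h k := dc_cls (a * h * b * k * c).
transitivity (seq_mset [seq t h k | k <- fsg_set H, h <- fsg_set H]).
  apply: mset_bind_seq; rewrite -!map_comp; apply: eq_map => k /=.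
  by rewrite dc_opE; congr seq_mset; apply: eq_map => h; rewrite /t !mulgA.
transitivity (seq_mset [seq t h k | h <- fsg_set H, k <- fsg_set H]); last first.
  apply/esym/mset_bind_seq; rewrite -!map_comp; apply: eq_map => h /=.
  by rewrite dc_opE.
apply/eq_seq_msetP/permP => p; rewrite !count_flatten -!map_comp !sumn_map.
have cE u : count p u = \sum_(w <- u) (p w : nat) by rewrite -sumn_map sumn_count.
under eq_bigr => k _ do rewrite /= cE big_map.
under [RHS]eq_bigr => k _ do rewrite /= cE big_map.
exact: exchange_big.
Qed.

Definition dc_one : dc_sort := dc_cls 1.

Definition dc_inv (x : dc_sort) : dc_sort := dc_cls (rep x)^-1.

Lemma dc_op1x x : dc_op dc_one x = msetn #|` fsg_set H| x.
Proof.
elim/dc_sort_ind: x => g; rewrite dc_opE -[RHS]seq_mset_id enum_msetn.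
congr seq_mset; apply: map_nseq_cst => h hH.
by apply/cls_eq/esym/dcoset_eqP; exists h, 1; rewrite fsg1 mulg1 mul1g.
Qed.

Lemma dc_opx1 x : dc_op x dc_one = msetn #|` fsg_set H| x.
Proof.
elim/dc_sort_ind: x => g; rewrite dc_opE -[RHS]seq_mset_id enum_msetn.
congr seq_mset; apply: map_nseq_cst => h hH.
by apply/cls_eq/esym/dcoset_eqP; exists 1, h; rewrite fsg1 mulg1 mul1g.
Qed.

Lemma dc_opVx x : dc_one \in dc_op (dc_inv x) x.
Proof.
rewrite -[X in dc_op _ X]repK dc_opE (perm_mem (perm_eq_seq_mset _)).
by apply/mapP; exists 1; rewrite ?fsg1 // mulg1 mulVg.
Qed.

Lemma dc_opxV x : dc_one \in dc_op x (dc_inv x).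
Proof.
rewrite -[X in dc_op X _]repK dc_opE (perm_mem (perm_eq_seq_mset _)).
by apply/mapP; exists 1; rewrite ?fsg1 // mulg1 mulgV.
Qed.

End DoubleCosets.

Definition dcoset_group (G : groupType) (H : finsubgroup G) :
    nvalued_group #|` fsg_set H| :=
  NValuedGroup (@dc_size G H) (@dc_assoc G H) (@dc_op1x G H) (@dc_opx1 G H)
    (@dc_opVx G H) (@dc_opxV G H).

(* Main.v *)
Require Import Defs.
From mathcomp Require Import all_boot all_algebra.
From mathcomp Require Import finmap multiset.
From HB Require Import structures.
From mathcomp Require Import boolp.

(** The operation of [XF F] is, up to signs, multiplication in the affine group
    of the line: composing the maps [x |-> a + b x] and [x |-> c + d x] gives
    the pair [(a + b c, b d)]. So take for [G] the affine group of [F], and for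
    [H] the subgroup [{1, s}] generated by the reflection [s : x |-> - x],
    which has order 2 exactly because 2 is nonzero in [F]. Multiplying [(a, b)]
    by [s] on the right gives [(a, - b)], and on the left gives [(- a, - b)];
    hence the two factors of [H] change the signs of [a] and [b]
    independently, and the double coset of [(a, b)] is precisely the pair of
    classes [([a], [b])]. Inserting [s] between two affine maps replaces [c] by
    [- c] (and [d] by [- d]), so the product of two double cosets consists of
    the classes of [(a + b c, b d)] and [(a - b c, b d)], as in [XF F].

    [dcoset_eq_affine] identifies the double cosets, [XF_op_affine] compares
    the products, and [nvg_isomorphic_dcoset] turns these two facts into an
    isomorphism. *)

Set Implicit Arguments.
Unset Strict Implicit.
Unset Printing Implicit Defensive.

Import GRing.Theory.

(** Like a first isomorphism theorem: it lets one work with a map defined on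
    group elements, where no representatives have to be chosen. *)
Lemma nvg_isomorphic_dcoset (G : groupType) (H : finsubgroup G) (n : nat)
    (X : nvalued_group n) (q : G -> X) :
  (forall x, exists g, q g = x) ->
  (forall g g', q g = q g' <-> dcoset H g = dcoset H g') ->
  (forall g g', nvg_op (q g) (q g') =
     seq_mset [seq q (g * h * g')%g | h <- fsg_set H]) ->
  nvg_isomorphic X (dcoset_group H).
Proof.
move=> q_surj q_eq q_op; have [s sK] := choice q_surj.
have clsE g : dc_cls H (s (q g)) = dc_cls H g by apply/cls_eq/q_eq; rewrite sK.
exists (fun x => dc_cls H (s x)); split=> [|x y].
  exists (fun D => q (rep D)) => [x|].
    by rewrite -[RHS]sK; apply/q_eq/repP.
  by elim/dc_sort_ind=> g; rewrite clsE; exact: repK.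
rewrite [LHS]dc_opE -{2}[x]sK -{2}[y]sK q_op.
apply/eq_seq_msetP; rewrite perm_sym.
apply: perm_trans (perm_map _ (perm_eq_seq_mset _)) _.
rewrite -map_comp; under eq_map => h do rewrite /= clsE.
exact: perm_refl.
Qed.

Section AffineGroup.
Variable F : fieldType.
Local Open Scope ring_scope.

(** The pair [(a, b)] stands for the map [x |-> a + b x]. The alias keeps the
    group structure below apart from that of a direct product. *)
Definition affine : Type := (F * nonzero F)%type.
HB.instance Definition _ := Choice.on affine.

Definition affine_one : affine := (0, nz1 F).
Definition affine_mul (g h : affine) : affine :=
  (g.1 + val g.2 * h.1, nzM g.2 h.2).
Definition affine_inv (g : affine) : affine :=
  (- ((val g.2)^-1 * g.1), nzV g.2).

Lemma affine_eq (g h : affine) : g.1 = h.1 -> val g.2 = val h.2 -> g = h.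
Proof. by case: g h => [a b] [c d] /= -> /val_inj ->. Qed.

Lemma affine_mulA : associative affine_mul.
Proof. by move=> g h k; apply: affine_eq; rewrite /= ?mulrDr ?addrA ?mulrA. Qed.

Lemma affine_mul1 : left_id affine_one affine_mul.
Proof. by move=> g; apply: affine_eq; rewrite /= mul1r ?add0r. Qed.

Lemma affine_mulr1 : right_id affine_one affine_mul.
Proof. by move=> g; apply: affine_eq; rewrite /= ?mulr0 ?addr0 ?mulr1. Qed.

Lemma affine_mulV : left_inverse affine_one affine_inv affine_mul.
Proof.
by move=> g; apply: affine_eq; rewrite /= ?addNr ?mulVf // (valP g.2).
Qed.

Lemma affine_mulrV : right_inverse affine_one affine_inv affine_mul.
Proof.
move=> g; have b0 := valP g.2; apply: affine_eq => /=; last by rewrite mulfV.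
by rewrite mulrN mulrA mulfV // mul1r subrr.
Qed.

HB.instance Definition _ := isGroup.Build affine affine_mulA affine_mul1
  affine_mulr1 affine_mulV affine_mulrV.

Definition nzN (b : nonzero F) : nonzero F :=
  exist _ (- val b) (etrans (congr1 negb (oppr_eq0 (val b))) (valP b)).

Definition reflection : affine := (0, nzN (nz1 F)).

Lemma mul_reflection (g : affine) : (reflection * g)%g = (- g.1, nzN g.2).
Proof. by apply: affine_eq; rewrite /= mulN1r ?add0r. Qed.

Lemma mulr_reflection (g : affine) : (g * reflection)%g = (g.1, nzN g.2).
Proof. by apply: affine_eq; rewrite /= ?mulr0 ?addr0 ?mulrN1. Qed.

Lemma reflectionK : (reflection * reflection = 1)%g.
Proof. by rewrite mul_reflection; apply: affine_eq; rewrite /= ?oppr0 ?opprK. Qed.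

Definition reflection_set : {fset affine} := [fset 1%g; reflection]%fset.

Lemma reflection_set_closed : group_closed [in reflection_set].
Proof.
have rV : (reflection^-1 = reflection)%g.
  by rewrite -[LHS]mulg1 -reflectionK mulKg.
split=> [|g h]; rewrite !inE ?eqxx //.
by case/orP=> /eqP-> /orP[]/eqP->; rewrite ?rV ?invg1 ?mul1g ?mulg1 ?reflectionK
  ?eqxx ?orbT.
Qed.

Definition reflection_group : finsubgroup affine :=
  FinSubgroup reflection_set_closed.

(** In characteristic 2 the reflection is the identity, and the subgroup it
    generates collapses to order 1. *)
Lemma reflection_neq1 : 2 \notin [pchar F] -> (1%g : affine) != reflection.
Proof.
apply: contra => /eqP/(congr1 (fun g : affine => val g.2)) /= e.
by rewrite inE /= mulr2n {2}e subrr.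
Qed.

Definition XF_affine (g : affine) : XF F := XF_cls g.1 g.2.

Lemma XF_affine_surj x : exists g, XF_affine g = x.
Proof. by elim/XF_sort_ind: x => a b; exists (a, b). Qed.

Lemma XF_affineP (g g' : affine) : XF_affine g = XF_affine g' <->
  (g'.1 = g.1 \/ g'.1 = - g.1) /\ (g'.2 = g.2 \/ g'.2 = nzN g.2).
Proof.
case: g g' => [a b] [c d] /=; split=> [[/pmP ea /pmP eb]|[ea eb]].
  by split=> //; case: eb => eb; [left | right]; apply: val_inj.
by congr (_, _); apply/cls_eq/pmP => //; case: eb => ->; [left | right].
Qed.

(** Right multiplication by the reflection negates the second entry alone, and
    multiplication on both sides negates the first alone, so the four products
    with elements of the subgroup realise all four choices of signs. *)
Lemma dcoset_eq_affine (g g' : affine) :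
  XF_affine g = XF_affine g' <->
  dcoset reflection_group g = dcoset reflection_group g'.
Proof.
have one_in : (1 : affine)%g \in reflection_set by rewrite !inE eqxx.
have refl_in : reflection \in reflection_set by rewrite !inE eqxx orbT.
have nzNK (b : nonzero F) : nzN (nzN b) = b by apply: val_inj; exact: opprK.
split=> [/XF_affineP|/dcoset_eqP[h [k [hH kH ->]]]].
  case: g g' => [a b] [c d] /= eab; apply/dcoset_eqP.
  case: eab => -[->|->] [->|->].
  - by exists 1%g, 1%g; rewrite mul1g mulg1.
  - by exists 1%g, reflection; rewrite mul1g mulr_reflection.
  (* The left factor also changes the sign of b; the right one restores it. *)
  - exists reflection, reflection.
    by rewrite mul_reflection mulr_reflection /= nzNK.
  - by exists reflection, 1%g; rewrite mulg1 mul_reflection.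
apply/XF_affineP; move: hH kH; rewrite !inE => /orP[]/eqP-> /orP[]/eqP->;
  by rewrite ?mul1g ?mulg1 ?mulr_reflection ?mul_reflection /= ?nzNK; auto.
Qed.

(** The two multisets agree term by term: the identity gives the term with
    [a + b c], and the reflection, which turns [b] into [- b], the one with
    [a - b c]. *)
Lemma XF_op_affine (g g' : affine) :
  2 \notin [pchar F] ->
  nvg_op (XF_affine g) (XF_affine g') =
  seq_mset [seq XF_affine (g * h * g')%g | h <- fsg_set reflection_group].
Proof.
move=> /reflection_neq1 neq1; rewrite [LHS]XF_opE.
have enumH : perm_eq reflection_set [:: 1%g; reflection].
  by apply: uniq_perm; rewrite ?fset_uniq /= ?inE ?neq1 // => h; rewrite !inE.
apply/eq_seq_msetP; rewrite perm_sym.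
apply: perm_trans (perm_map _ enumH) _.
rewrite /= mulg1 mulr_reflection.
suff -> : XF_affine (((g.1, nzN g.2) : affine) * g')%g
        = XF_cls (g.1 - val g.2 * g'.1) (nzM g.2 g'.2) by exact: perm_refl.
rewrite -[RHS]/(XF_affine (_, _)); apply/XF_affineP => /=; split.
  by left; rewrite mulNr.
by right; apply: val_inj; rewrite /= mulNr opprK.
Qed.

End AffineGroup.

Theorem theorem1p9 (F : fieldType) (charF_neq2 : 2 \notin [pchar F]%R) :
  exists (G : groupType) (H : finsubgroup G),
    #|` fsg_set H|%fset = 2 /\ nvg_isomorphic (XF F) (dcoset_group H).
Proof.
exists (affine F), (reflection_group F); split.
  by rewrite cardfs2 reflection_neq1.
apply: (nvg_isomorphic_dcoset (q := @XF_affine F)).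
- exact: XF_affine_surj.
- exact: dcoset_eq_affine.
- by move=> g g'; exact: XF_op_affine.
Qed.
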